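(* Let $q,a,b$ be nonzero complex numbers with $|q|<1$ and $\max\{|ab|,|aq^2|,|bq^2|\}<1$. Then $$\frac{(q^2,ab;q^2)_\infty}{(aq^2,bq^2;q^2)_\infty}\;{}_3\phi_2\left(\begin{matrix}q^2/a,\,q^2/b,\,q^2\\ -q^2,\,-q^3\end{matrix};q^2,ab\right)=(1+q)\sum_{n=0}^\infty\sum_{j=-n}^n(-1)^j(1-q^{2n+1})\frac{(q^2/a,q^2/b;q^2)_n}{(aq^2,bq^2;q^2)_n}(ab)^nq^{2n^2+n-j^2}.$$
   Context: Notation, for a base $p$ with $|p|<1$: $(x;p)_0=1$, $(x;p)_n=\prod_{k=0}^{n-1}(1-xp^k)$, $(x;p)_\infty=\prod_{k=0}^\infty(1-xp^k)$, $(x_1,\dots,x_k;p)_n=(x_1;p)_n\cdots(x_k;p)_n$ (also for $n=\infty$), and $${}_3\phi_2\left(\begin{matrix}A_1,A_2,A_3\\ B_1,B_2\end{matrix};p,z\right)=\sum_{n=0}^\infty\frac{(A_1,A_2,A_3;p)_n}{(p,B_1,B_2;p)_n}z^n .$$ *)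

(* Defs.v *)
From Stdlib Require Export Reals ZArith.
From Coquelicot Require Export Coquelicot.

Open Scope C_scope.

(* $(x;p)_n$ *)
Fixpoint qpoch (x p : C) (n : nat) : C :=
  match n with
  | O => 1
  | S k => qpoch x p k * (1 - x * p ^ k)
  end.

(* $(x;p)_\infty$.  As with [RInt], [iota] returns the limit when it exists
   and an unspecified value otherwise. *)
Definition qpoch_inf (x p : C) : C :=
  iota (fun l : C_CompleteNormedModule =>
          filterlim (qpoch x p) eventually (locally l)).

(* Coquelicot's [Series] only covers real series. *)
Definition CSeries (a : nat -> C) : C :=
  iota (fun l : C_CompleteNormedModule => is_series a l).

Lemma qpoch_inf_unique (x p l : C) :
  filterlim (qpoch x p) eventually (locally (l : C_CompleteNormedModule)) ->
  qpoch_inf x p = l.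
Proof.
  intros H.
  exact (iota_filterlim_locally (V := C_CompleteNormedModule) _ _ H).
Qed.

Lemma CSeries_unique (a : nat -> C) (l : C) :
  is_series (V := C_CompleteNormedModule) a l -> CSeries a = l.
Proof.
  intros H.
  exact (iota_filterlim_locally (V := C_CompleteNormedModule) _ _ H).
Qed.

Definition phi32_term (A1 A2 A3 B1 B2 p z : C) (n : nat) : C :=
  (qpoch A1 p n * qpoch A2 p n * qpoch A3 p n)
  / (qpoch p p n * qpoch B1 p n * qpoch B2 p n) * z ^ n.

Definition phi32 (A1 A2 A3 B1 B2 p z : C) : C :=
  CSeries (phi32_term A1 A2 A3 B1 B2 p z).

(* Integer powers, the analogue of [powerRZ]. *)
Definition CpowZ (z : C) (k : Z) : C :=
  match k with
  | Z0 => 1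
  | Zpos m => z ^ Pos.to_nat m
  | Zneg m => / (z ^ Pos.to_nat m)
  end.

(* $\sum_{j=-n}^n f(j)$: [sum_n u N] has the N+1 terms u 0, ..., u N. *)
Definition sum_sym (f : Z -> C) (n : nat) : C :=
  sum_n (fun i : nat => f (Z.of_nat i - Z.of_nat n)%Z) (2 * n).

Definition hecke_term (q a b : C) (n : nat) : C :=
  sum_sym (fun j : Z =>
    CpowZ (-1) j * (1 - q ^ (2 * n + 1))
    * ((qpoch (q ^ 2 / a) (q ^ 2) n * qpoch (q ^ 2 / b) (q ^ 2) n)
       / (qpoch (a * q ^ 2) (q ^ 2) n * qpoch (b * q ^ 2) (q ^ 2) n))
    * (a * b) ^ n
    * CpowZ q (2 * Z.of_nat n ^ 2 + Z.of_nat n - j ^ 2)) n.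

(* Main.v *)
(** Put p = q^2.  The numbers beta_j = 1/(-q^2,-q^3;p)_j form a Bailey pair
    relative to p with alpha_n proportional to
    (1 - q^(2n+1)) q^(2n^2+n) sum_{|j|<=n} (-1)^j q^(-j^2): inverting the Bailey
    relation writes alpha_n as a terminating sum over beta_0, ..., beta_n, which
    satisfies the same first-order recurrence in n as the theta-like sum, by
    telescoping in j.  Substituting that expression on the right-hand side and
    summing over n first leaves, for each j, a limiting very-well-poised 6phi5
    series, whose value is an infinite product; this gives the 3phi2 series term
    by term.  The 6phi5 sum itself follows from a contiguous relation A -> A p
    and the limit A p^n -> 0. *)

From Stdlib Require Import Lia Lra.
Require Import Defs.

(** * Limits and series of complex numbers *)

(** The cast selects the topology used by [qpoch_inf] and [CSeries], so limits found here feed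
    [qpoch_inf_unique] directly. *)
Notation Clim u l :=
  (filterlim u eventually (locally (l : C_CompleteNormedModule))).

(** Turns complex limits into real null sequences, where squeezing and geometric bounds apply. *)
Lemma Clim_Cmod (u : nat -> C) (l : C) :
  Clim u l <-> is_lim_seq (fun n => Cmod (u n - l)) 0%R.
Proof.
rewrite (filterlim_locally_ball_norm (U := C_CompleteNormedModule)).
rewrite <- is_lim_seq_spec.
split; intros H eps; destruct (H eps) as [N HN]; exists N; intros n Hn;
  specialize (HN n Hn).
- rewrite Rminus_0_r, Rabs_pos_eq by apply Cmod_ge_0. exact HN.
- rewrite Rminus_0_r, Rabs_pos_eq in HN by apply Cmod_ge_0. exact HN.
Qed.

Lemma Clim_const (l : C) : Clim (fun _ => l) l.
Proof. apply filterlim_const. Qed.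

Lemma Clim_ext (u v : nat -> C) (l : C) :
  (forall n, u n = v n) -> Clim u l -> Clim v l.
Proof. intros H. apply filterlim_ext; exact H. Qed.

Lemma Clim_unique (u : nat -> C) (l l' : C) : Clim u l -> Clim u l' -> l = l'.
Proof. apply (filterlim_locally_unique (V := C_CompleteNormedModule)). Qed.

Lemma Clim_plus (u v : nat -> C) (l m : C) :
  Clim u l -> Clim v m -> Clim (fun n => u n + v n) (l + m).
Proof.
intros Hu Hv. eapply filterlim_comp_2; [exact Hu | exact Hv |].
exact (filterlim_plus (V := C_NormedModule) l m).
Qed.

Lemma Clim_Cmod_le (u : nat -> C) (l : C) (v : nat -> R) :
  (forall n, (Cmod (u n - l) <= v n)%R) -> is_lim_seq v 0%R -> Clim u l.
Proof.
intros H Hv. apply Clim_Cmod.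
apply is_lim_seq_le_le with (fun _ => 0%R) v;
  [ | apply is_lim_seq_const | exact Hv].
intros n; split; [apply Cmod_ge_0 | apply H].
Qed.

Lemma Clim_mult (u v : nat -> C) (l m : C) :
  Clim u l -> Clim v m -> Clim (fun n => u n * v n) (l * m).
Proof.
rewrite (Clim_Cmod u), (Clim_Cmod v). intros Hu Hv.
apply Clim_Cmod_le with (fun n => Cmod (u n - l) * Cmod (v n - m)
  + (Cmod l * Cmod (v n - m) + Cmod m * Cmod (u n - l)))%R.
- intros n. rewrite <- !Cmod_mult.
  replace (u n * v n - l * m)
    with ((u n - l) * (v n - m) + (l * (v n - m) + m * (u n - l))) by ring.
  eapply Rle_trans; [apply Cmod_triangle|].
  apply Rplus_le_compat_l, Cmod_triangle.
- replace 0%R with (0 * 0 + (Cmod l * 0 + Cmod m * 0))%R by ring.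
  apply is_lim_seq_plus'; [now apply is_lim_seq_mult'|].
  apply is_lim_seq_plus'; apply is_lim_seq_mult';
    solve [assumption | apply is_lim_seq_const].
Qed.

Lemma Clim_shift (u : nat -> C) (l : C) (k : nat) :
  Clim u l -> Clim (fun n => u (k + n)%nat) l.
Proof.
rewrite !Clim_Cmod. intros H.
apply (is_lim_seq_incr_n _ k) in H.
apply is_lim_seq_ext with (2 := H).
intros n. now rewrite Nat.add_comm.
Qed.

Lemma Clim_S (u : nat -> C) (l : C) : Clim (fun n => u (S n)) l -> Clim u l.
Proof.
rewrite !Clim_Cmod. apply (is_lim_seq_incr_1 (fun n => Cmod (u n - l))).
Qed.

Lemma is_lim_seq_scal_geom (K x : R) :
  (0 <= x < 1)%R -> is_lim_seq (fun n => K * x ^ n)%R 0%R.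
Proof.
intros Hx. replace (Finite 0) with (Rbar_mult K 0%R)
  by (simpl; f_equal; ring).
apply is_lim_seq_scal_l, is_lim_seq_geom. rewrite Rabs_pos_eq; lra.
Qed.

(** Each of the n+1 terms of 1 + x + ... + x^n is at least x^n, and this sum times 1 - x is 1 -
    x^(n+1). The induction is run on that sharper bound. *)
Lemma Bernoulli_pow_le (x : R) (n : nat) :
  (0 <= x < 1)%R -> (INR (S n) * x ^ n * (1 - x) <= 1)%R.
Proof.
intros Hx.
enough (INR (S n) * x ^ n * (1 - x) <= 1 - x ^ S n)%R.
{ pose proof (pow_le x (S n) (proj1 Hx)). lra. }
induction n as [|n IH]; [simpl; lra|].
rewrite S_INR, <- !tech_pow_Rmult. rewrite <- tech_pow_Rmult in IH.
set (X := (x ^ n)%R) in *. set (a := INR (S n)) in *.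
assert (HX : (0 <= X <= 1)%R).
{ split; [apply pow_le; lra|]. unfold X. rewrite <- (pow1 n).
  apply pow_incr; lra. }
assert (x * (a * X * (1 - x)) <= x * (1 - x * X))%R
  by (apply Rmult_le_compat_l; lra).
assert (0 <= (1 - x) * (1 - x * X))%R by (apply Rmult_le_pos; nra).
lra.
Qed.

Lemma is_lim_seq_INR_geom (K x : R) :
  (0 <= K)%R -> (0 <= x < 1)%R ->
  is_lim_seq (fun n => K * INR (S n) * x ^ n)%R 0%R.
Proof.
intros HK Hx.
(* With s = sqrt x, the factor (n+1) s^n is bounded and s^n tends to 0. *)
set (s := sqrt x).
assert (Hs : (0 <= s < 1)%R).
{ split; [apply sqrt_pos|]. rewrite <- sqrt_1. apply sqrt_lt_1_alt. lra. }
assert (Hss : x = (s * s)%R) by (symmetry; apply sqrt_sqrt; lra).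
apply is_lim_seq_le_le with (fun _ => 0%R) (fun n => K / (1 - s) * s ^ n)%R;
  [ | apply is_lim_seq_const | now apply is_lim_seq_scal_geom].
intros n. rewrite Hss, Rpow_mult_distr.
pose proof (Bernoulli_pow_le s n Hs) as HB.
pose proof (pow_le s n (proj1 Hs)) as Hn.
pose proof (pos_INR (S n)) as HI.
split.
- repeat apply Rmult_le_pos; assumption.
- replace (K * INR (S n) * (s ^ n * s ^ n))%R
    with (K * s ^ n / (1 - s) * (INR (S n) * s ^ n * (1 - s)))%R
    by (field; lra).
  replace (K / (1 - s) * s ^ n)%R with (K * s ^ n / (1 - s) * 1)%R
    by (field; lra).
  apply Rmult_le_compat_l; [|exact HB].
  apply Rmult_le_pos; [apply Rmult_le_pos; assumption|].
  apply Rlt_le, Rinv_0_lt_compat; lra.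
Qed.

Lemma Csum_Sn (u : nat -> C) (n : nat) :
  sum_n u (S n) = sum_n u n + u (S n) :> C.
Proof. exact (sum_Sn u n). Qed.

Lemma is_series_C_scal (c l : C) (u : nat -> C) :
  is_series u l -> is_series (fun n => c * u n) (c * l).
Proof. exact (is_series_scal (V := C_NormedModule) c u l). Qed.

(** Comparison with a geometric series. The explicit tail bound matters because the interchange of
    summations needs a rate, not only convergence. *)
Lemma is_series_geom_bound (u : nat -> C) (K x : R) :
  (0 <= x < 1)%R -> (forall n, (Cmod (u n) <= K * x ^ n)%R) ->
  exists l : C, is_series u l /\
    forall n, (Cmod (l - sum_n u n) <= K / (1 - x) * x ^ S n)%R.
Proof.
intros Hx Hu.
assert (HK : (0 <= K)%R).
{ specialize (Hu 0%nat). pose proof (Cmod_ge_0 (u 0%nat)). simpl in Hu. lra. }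
assert (Hex : ex_series (fun n => K * x ^ n)%R).
{ apply (ex_series_scal (V := R_NormedModule) K (fun n => x ^ n)%R).
  apply ex_series_geom. rewrite Rabs_pos_eq; lra. }
assert (Hsum : ex_series u).
{ apply (ex_series_le (V := C_CompleteNormedModule)) with (2 := Hex).
  exact Hu. }
destruct Hsum as [l Hl]. exists l. split; [exact Hl|].
intros n.
(* The right-hand side is the exact sum of K x^i for i from n+1 to n+1+m, so the induction closes
   without loss; letting m grow gives the tail. *)
assert (Htail : forall m, (Cmod (sum_n u (S n + m) - sum_n u n)
   <= K / (1 - x) * (x ^ S n - x ^ S (S n + m)))%R).
{ induction m as [|m IH].
  - rewrite Nat.add_0_r, Csum_Sn.
    replace (sum_n u n + u (S n) - sum_n u n) with (u (S n)) by ring.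
    eapply Rle_trans; [apply Hu|]. right. simpl. field. lra.
  - rewrite Nat.add_succ_r, Csum_Sn.
    match goal with |- (Cmod (?s + ?t - ?r) <= _)%R =>
      replace (s + t - r) with ((s - r) + t) by ring end.
    eapply Rle_trans; [apply Cmod_triangle|].
    eapply Rle_trans; [apply Rplus_le_compat; [exact IH | apply Hu]|].
    right. rewrite <- !(tech_pow_Rmult _ (S _)). field. lra. }
assert (Hlim : Clim (fun m => sum_n u (S n + m) - sum_n u n) (l - sum_n u n)).
{ apply Clim_plus; [|apply Clim_const]. now apply Clim_shift. }
apply (filterlim_comp _ _ _ _ Cmod) with (H := locally (Cmod (l - sum_n u n)))
  in Hlim; [|exact (filterlim_norm (V := C_NormedModule) _)].
apply (is_lim_seq_le _ (fun _ => K / (1 - x) * x ^ S n)%R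
         (Cmod (l - sum_n u n)) (K / (1 - x) * x ^ S n)%R) in Hlim;
  [exact Hlim | | apply is_lim_seq_const].
intros m. eapply Rle_trans; [apply Htail|].
apply Rmult_le_compat_l.
- apply Rmult_le_pos; [exact HK|]. apply Rlt_le, Rinv_0_lt_compat; lra.
- pose proof (pow_le x (S (S n + m)) (proj1 Hx)). lra.
Qed.

Lemma sum_n_triangle (f : nat -> nat -> C) (N : nat) :
  sum_n (fun n => sum_n (fun j => f j (n - j)%nat) n) N
  = sum_n (fun j => sum_n (f j) (N - j)) N.
Proof.
induction N as [|N IH]; [now rewrite !sum_O|].
rewrite (sum_Sn _ N), IH, !(sum_Sn _ N), Nat.sub_diag, sum_O.
rewrite plus_assoc. f_equal. rewrite <- sum_n_plus.
apply sum_n_ext_loc. intros j Hj.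
now rewrite (Nat.sub_succ_l _ _ Hj), sum_Sn.
Qed.

Lemma Cmod_sum_n_le (u : nat -> C) (K : R) (N : nat) :
  (forall n, (n <= N)%nat -> (Cmod (u n) <= K)%R) ->
  (Cmod (sum_n u N) <= INR (S N) * K)%R.
Proof.
induction N as [|N IH]; intros H.
- rewrite sum_O, Rmult_1_l. now apply H.
- rewrite Csum_Sn, S_INR.
  eapply Rle_trans; [apply Cmod_triangle|].
  rewrite Rmult_plus_distr_r, Rmult_1_l.
  apply Rplus_le_compat; [apply IH; intros n Hn; apply H; lia | now apply H].
Qed.

Lemma sum_n_Cminus (u v : nat -> C) (N : nat) :
  sum_n (fun n => u n - v n) N = sum_n u N - sum_n v N :> C.
Proof.
induction N as [|N IH]; [now rewrite !sum_O|].
rewrite !Csum_Sn, IH. ring.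
Qed.

(** Summing over antidiagonals up to N misses, from the first N+1 row sums, one tail per row. Row j
    is cut after N-j, so every tail is at most K/(1-x) x^(N+1), and N+1 of them still tend to 0. *)
Lemma is_series_triangle (f : nat -> nat -> C) (g : nat -> C) (l : C)
    (K x : R) :
  (0 <= x < 1)%R ->
  (forall j m, (Cmod (f j m) <= K * x ^ (j + m))%R) ->
  (forall j, is_series (f j) (g j)) ->
  is_series g l ->
  is_series (fun n => sum_n (fun j => f j (n - j)%nat) n) l.
Proof.
intros Hx Hf Hfg Hg.
assert (Htail : forall j m,
  (Cmod (g j - sum_n (f j) m) <= K / (1 - x) * x ^ S (j + m))%R).
{ intros j m.
  destruct (is_series_geom_bound (f j) (K * x ^ j) x Hx) as [l' [Hl' Hb]].
  { intros n. rewrite Rmult_assoc, <- pow_add. apply Hf. }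
  rewrite (filterlim_locally_unique (V := C_NormedModule) _ _ _ (Hfg j) Hl').
  eapply Rle_trans; [apply Hb|]. right.
  rewrite <- Nat.add_succ_r, pow_add. field. lra. }
assert (HK : (0 <= K)%R).
{ specialize (Hf 0%nat 0%nat). pose proof (Cmod_ge_0 (f 0%nat 0%nat)).
  simpl in Hf. lra. }
apply Clim_ext with (fun N => sum_n g N
    + - sum_n (fun j => g j - sum_n (f j) (N - j)) N).
{ intros N. rewrite sum_n_triangle, sum_n_Cminus. ring. }
replace l with (l + - 0) by ring.
apply Clim_plus; [exact Hg|].
apply Clim_Cmod_le with (fun N => K / (1 - x) * x * INR (S N) * x ^ N)%R.
- intros N. replace (- sum_n (fun j => g j - sum_n (f j) (N - j)) N - - 0)
    with (- sum_n (fun j => g j - sum_n (f j) (N - j)) N) by ring.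
  rewrite Cmod_opp.
  eapply Rle_trans.
  + apply Cmod_sum_n_le. intros j Hj. eapply Rle_trans; [apply Htail|].
    replace (j + (N - j))%nat with N by lia. apply Rle_refl.
  + right. rewrite <- tech_pow_Rmult. ring.
- apply is_lim_seq_INR_geom; [|exact Hx].
  repeat apply Rmult_le_pos; try lra.
  apply Rlt_le, Rinv_0_lt_compat; lra.
Qed.

(** * Infinite q-shifted factorials *)

Lemma exp_geom_sum_le (t r : R) (n : nat) :
  (0 <= t)%R -> (0 <= r < 1)%R ->
  (exp (t * (1 - r ^ n) / (1 - r)) <= exp (t / (1 - r)))%R.
Proof.
intros Ht Hr.
assert (H : (t * (1 - r ^ n) / (1 - r) <= t / (1 - r))%R).
{ apply Rmult_le_compat_r; [apply Rlt_le, Rinv_0_lt_compat; lra|].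
  pose proof (Rmult_le_pos _ _ Ht (pow_le r n (proj1 Hr))). lra. }
destruct H as [H | ->]; [left; now apply exp_increasing | right; easy].
Qed.

(** Each factor satisfies |1 - x p^k| <= 1 + t|p|^k <= exp(t|p|^k), and the exponents form a
    geometric sum. The bound is uniform in n and in |x| <= t. *)
Lemma Cmod_qpoch_le (x p : C) (t : R) (n : nat) :
  (Cmod p < 1)%R -> (Cmod x <= t)%R ->
  (Cmod (qpoch x p n) <= exp (t / (1 - Cmod p)))%R.
Proof.
intros Hp Hx.
pose proof (Cmod_ge_0 p) as Hp0. pose proof (Cmod_ge_0 x) as Hx0.
set (r := Cmod p) in *.
apply Rle_trans with (exp (t * (1 - r ^ n) / (1 - r))).
- induction n as [|n IH].
  + simpl. rewrite Cmod_1, Rminus_diag, Rmult_0_r, Rdiv_0_l, exp_0. lra.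
  + simpl qpoch. rewrite Cmod_mult.
    replace (t * (1 - r ^ S n) / (1 - r))%R
      with (t * (1 - r ^ n) / (1 - r) + t * r ^ n)%R
      by (simpl; field; lra).
    rewrite exp_plus.
    apply Rmult_le_compat; try apply Cmod_ge_0; [exact IH|].
    apply Rle_trans with (1 + t * r ^ n)%R; [|apply exp_ineq1_le].
    eapply Rle_trans; [apply Cmod_triangle|].
    rewrite Cmod_1, Cmod_opp, Cmod_mult, Cmod_pow.
    apply Rplus_le_compat_l, Rmult_le_compat_r; [now apply pow_le | exact Hx].
- apply exp_geom_sum_le; lra.
Qed.

(** With s = t/(1-t) and 0 <= y <= 1 one has (1 + s y)(1 - t y) >= 1, so each factor 1 - x p^k is
    compensated by exp(s|p|^k). The product form avoids dividing before nonvanishing is known. *)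
Lemma Cmod_qpoch_ge (x p : C) (t : R) (n : nat) :
  (Cmod p < 1)%R -> (Cmod x <= t < 1)%R ->
  (1 <= exp (t / (1 - t) / (1 - Cmod p)) * Cmod (qpoch x p n))%R.
Proof.
intros Hp Hx.
pose proof (Cmod_ge_0 p) as Hp0. pose proof (Cmod_ge_0 x) as Hx0.
set (r := Cmod p) in *. set (s := (t / (1 - t))%R).
assert (Hs : (0 <= s)%R).
{ apply Rmult_le_pos; [lra|]. apply Rlt_le, Rinv_0_lt_compat; lra. }
apply Rle_trans with (exp (s * (1 - r ^ n) / (1 - r)) * Cmod (qpoch x p n))%R.
- induction n as [|n IH].
  + simpl. rewrite Cmod_1, Rminus_diag, Rmult_0_r, Rdiv_0_l, exp_0. lra.
  + simpl qpoch. rewrite Cmod_mult.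
    replace (s * (1 - r ^ S n) / (1 - r))%R
      with (s * (1 - r ^ n) / (1 - r) + s * r ^ n)%R
      by (simpl; field; lra).
    rewrite exp_plus.
    assert (Hr : (0 <= r ^ n <= 1)%R).
    { split; [now apply pow_le|]. rewrite <- (pow1 n). apply pow_incr. lra. }
    assert (H1 : (1 - t * r ^ n <= Cmod (1 - x * p ^ n))%R).
    { apply Rle_trans with (1 - Cmod (x * p ^ n))%R.
      - rewrite Cmod_mult, Cmod_pow. fold r. nra.
      - pose proof (Cmod_triangle (1 - x * p ^ n) (x * p ^ n)) as H.
        replace (1 - x * p ^ n + x * p ^ n) with (RtoC 1) in H by ring.
        rewrite Cmod_1 in H. lra. }
    assert (H2 : (1 <= exp (s * r ^ n) * Cmod (1 - x * p ^ n))%R).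
    { apply Rle_trans with ((1 + s * r ^ n) * (1 - t * r ^ n))%R.
      - unfold s.
        replace ((1 + t / (1 - t) * r ^ n) * (1 - t * r ^ n))%R
          with (1 + t * t * r ^ n * (1 - r ^ n) / (1 - t))%R by (field; lra).
        assert (0 <= t * t * r ^ n * (1 - r ^ n) / (1 - t))%R; [|lra].
        apply Rmult_le_pos; [|apply Rlt_le, Rinv_0_lt_compat; lra].
        repeat apply Rmult_le_pos; lra.
      - apply Rmult_le_compat; [nra | nra | apply exp_ineq1_le | exact H1]. }
    match goal with |- (_ <= ?a * ?b * (?c * ?d))%R =>
      replace (a * b * (c * d))%R with ((a * c) * (b * d))%R by ring end.
    nra.
- apply Rmult_le_compat_r; [apply Cmod_ge_0|].
  apply exp_geom_sum_le; [exact Hs | lra].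
Qed.

Lemma qpoch_neq_0 (x p : C) (n : nat) :
  (Cmod p < 1)%R -> (Cmod x < 1)%R -> qpoch x p n <> 0.
Proof.
intros Hp Hx H.
pose proof (Cmod_qpoch_ge x p (Cmod x) n Hp) as H1.
rewrite H, Cmod_0, Rmult_0_r in H1. lra.
Qed.

Lemma Cmod_inv_qpoch_le (x p : C) (t : R) (n : nat) :
  (Cmod p < 1)%R -> (Cmod x <= t < 1)%R ->
  (Cmod (/ qpoch x p n) <= exp (t / (1 - t) / (1 - Cmod p)))%R.
Proof.
intros Hp Hx.
assert (H0 : qpoch x p n <> 0) by (apply qpoch_neq_0; lra).
rewrite Cmod_inv by exact H0.
apply Cmod_gt_0 in H0.
apply Rmult_le_reg_r with (1 := H0).
rewrite Rinv_l by lra. now apply Cmod_qpoch_ge.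
Qed.

Lemma qpoch_add (x p : C) (m n : nat) :
  qpoch x p (m + n) = qpoch x p m * qpoch (x * p ^ m) p n.
Proof.
induction n as [|n IH]; simpl.
- rewrite Nat.add_0_r. ring.
- rewrite Nat.add_succ_r. simpl. rewrite IH, Cpow_add_r. ring.
Qed.

Lemma qpoch_S_l (x p : C) (n : nat) :
  qpoch x p (S n) = (1 - x) * qpoch (x * p) p n.
Proof.
change (S n) with (1 + n)%nat. rewrite qpoch_add, Cpow_1_r. simpl. ring.
Qed.

(** Consecutive partial products differ by -(x;p)_n x p^n, which is geometrically small since
    (x;p)_n is bounded; the product thus becomes a convergent telescoping series. *)
Lemma Clim_qpoch (x p : C) :
  (Cmod p < 1)%R -> Clim (qpoch x p) (qpoch_inf x p).
Proof.
intros Hp.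
pose proof (Cmod_ge_0 p) as Hp0.
destruct (is_series_geom_bound (fun n => - (qpoch x p n * (x * p ^ n)))
  (exp (Cmod x / (1 - Cmod p)) * Cmod x) (Cmod p)) as [l [Hl _]]; [lra | |].
{ intros n. rewrite Cmod_opp, !Cmod_mult, Cmod_pow, <- Rmult_assoc.
  apply Rmult_le_compat_r; [now apply pow_le|].
  apply Rmult_le_compat_r; [apply Cmod_ge_0|].
  apply Cmod_qpoch_le; [exact Hp | apply Rle_refl]. }
assert (H : Clim (qpoch x p) (1 + l)).
{ apply Clim_S.
  apply Clim_ext with
    (fun n => 1 + sum_n (fun n => - (qpoch x p n * (x * p ^ n))) n).
  - induction n as [|n IH].
    + rewrite sum_O. simpl. ring.
    + rewrite Csum_Sn, Cplus_assoc, IH. simpl. ring.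
  - apply Clim_plus; [apply Clim_const | exact Hl]. }
now rewrite (qpoch_inf_unique _ _ _ H).
Qed.

(** The lower bound of [Cmod_qpoch_ge] does not depend on n, so it survives in the limit. *)
Lemma qpoch_inf_neq_0 (x p : C) :
  (Cmod p < 1)%R -> (Cmod x < 1)%R -> qpoch_inf x p <> 0.
Proof.
intros Hp Hx H0.
pose proof (Clim_qpoch x p Hp) as H. rewrite H0 in H.
apply Clim_Cmod in H.
set (k := exp (Cmod x / (1 - Cmod x) / (1 - Cmod p))).
apply (is_lim_seq_scal_l _ k) in H.
apply (is_lim_seq_le (fun _ => 1%R) _ 1%R (k * 0)%R) in H;
  [simpl in H; lra | | apply is_lim_seq_const].
intros n. replace (qpoch x p n - 0) with (qpoch x p n) by ring.
apply Cmod_qpoch_ge; [exact Hp | lra].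
Qed.

Lemma qpoch_inf_split (x p : C) (n : nat) :
  (Cmod p < 1)%R ->
  qpoch_inf x p = qpoch x p n * qpoch_inf (x * p ^ n) p.
Proof.
intros Hp. apply Clim_unique with (fun m => qpoch x p (n + m)).
- apply Clim_shift. now apply Clim_qpoch.
- apply Clim_ext with (fun m => qpoch x p n * qpoch (x * p ^ n) p m).
  + intros m. now rewrite qpoch_add.
  + apply Clim_mult; [apply Clim_const | now apply Clim_qpoch].
Qed.

(** * A limiting case of the very-well-poised 6phi5 sum *)

(* $(-1)^n p^{n(n-1)/2}$ *)
Fixpoint qsign (p : C) (n : nat) : C :=
  match n with
  | O => 1
  | S k => qsign p k * - p ^ k
  end.

(** As E tends to infinity, (E;p)_n (Ap/(BDE))^n tends to (-1)^n p^(n(n-1)/2) (Ap/(BD))^n, which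
    explains [qsign] and the last power. Denominators are written as separate inverses so that each
    can be bounded alone. *)
Definition phi65_weight (A B D p : C) (n : nat) : C :=
  qpoch A p n * qpoch B p n * qpoch D p n
  * (/ qpoch p p n * / qpoch (A * p / B) p n * / qpoch (A * p / D) p n)
  * qsign p n * (A * p / (B * D)) ^ n.

(* Up to the factor $1-A$, the very-well-poised series $_6\phi_5$ with leading
   parameter $A$ and further parameters $B$, $D$ and $E \to \infty$. *)
Definition phi65_term (A B D p : C) (n : nat) : C :=
  (1 - A * p ^ (2 * n)) * phi65_weight A B D p n.

Lemma qpoch_shift_base (x p : C) (n : nat) :
  x <> 1 -> qpoch (x * p) p n = qpoch x p n * (1 - x * p ^ n) / (1 - x).
Proof.
intros Hx. assert (H : 1 - x <> 0).
{ intros H. apply Hx. replace x with (1 - (1 - x)) by ring. rewrite H. ring. }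
assert (E : (1 - x) * qpoch (x * p) p n = qpoch x p n * (1 - x * p ^ n))
  by (rewrite <- qpoch_S_l; reflexivity).
rewrite <- E. field. exact H.
Qed.

Lemma Cmod_lt_1_neq (x : C) : (Cmod x < 1)%R -> 1 - x <> 0.
Proof.
intros Hx H. replace x with (1 - (1 - x)) in Hx by ring.
rewrite H in Hx. replace (1 - 0) with (RtoC 1) in Hx by ring.
rewrite Cmod_1 in Hx. lra.
Qed.

Lemma Cmod_mult_pow_lt_1 (x p : C) (n : nat) :
  (Cmod p < 1)%R -> (Cmod x < 1)%R -> (Cmod (x * p ^ n) < 1)%R.
Proof.
intros Hp Hx. rewrite Cmod_mult, Cmod_pow.
pose proof (Cmod_ge_0 x) as Hx0. pose proof (Cmod_ge_0 p) as Hp0.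
assert (0 <= Cmod p ^ n <= 1)%R; [|nra].
split; [now apply pow_le|]. rewrite <- (pow1 n). apply pow_incr. lra.
Qed.

(** Telescoping certificate for the relation between A and Ap. The factor 1 - p^n makes it vanish at
    n = 0, so a partial sum leaves only its upper boundary value. *)
Definition phi65_tele (A B D p : C) (n : nat) : C :=
  - (1 - A * p / B) * (1 - A * p / D) * (1 - p ^ n) * phi65_weight A B D p n.

(** Passing from A to Ap or from n to n+1 changes each shifted factorial by simple linear factors,
    so only a rational identity in p^n remains. *)
Lemma phi65_term_contiguous (A B D p : C) (n : nat) :
  p <> 0 -> B <> 0 -> D <> 0 -> (Cmod p < 1)%R -> (Cmod A < 1)%R ->
  (Cmod (A * p / B) < 1)%R -> (Cmod (A * p / D) < 1)%R ->
  (1 - A * p / B) * (1 - A * p / D) * phi65_term A B D p n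
  - (1 - A) * (1 - A * p / (B * D)) * phi65_term (A * p) B D p n
  = phi65_tele A B D p (S n) - phi65_tele A B D p n.
Proof.
intros Hp0 HB HD Hp HA Hu Hv.
unfold phi65_tele, phi65_term, phi65_weight.
replace (A * p * p / B) with (A * p / B * p) by (field; assumption).
replace (A * p * p / D) with (A * p / D * p) by (field; assumption).
replace (A * p * p / (B * D)) with (A * p / (B * D) * p)
  by (field; split; assumption).
assert (Hne : forall x, (Cmod x < 1)%R -> x <> 1).
{ intros x Hx ->. rewrite Cmod_1 in Hx. lra. }
rewrite !qpoch_shift_base by (apply Hne; assumption).
pose proof (qpoch_neq_0 p p n Hp Hp) as Hpn.
pose proof (qpoch_neq_0 _ p n Hp Hu) as Hun.
pose proof (qpoch_neq_0 _ p n Hp Hv) as Hvn.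
pose proof (Cmod_lt_1_neq _ (Cmod_mult_pow_lt_1 p p n Hp Hp)) as Hp1.
pose proof (Cmod_lt_1_neq _ (Cmod_mult_pow_lt_1 _ p n Hp Hu)) as Hu1.
pose proof (Cmod_lt_1_neq _ (Cmod_mult_pow_lt_1 _ p n Hp Hv)) as Hv1.
pose proof (Cmod_lt_1_neq _ Hu) as Hu0. pose proof (Cmod_lt_1_neq _ Hv) as Hv0.
pose proof (Cmod_lt_1_neq _ HA) as HA0.
assert (HA1 : A <> 1) by (now apply Hne).
clear Hne HA Hu Hv Hp.
(* With B, D and z as free parameters, the lower parameters Ap/B and Ap/D become the products Dz and
   Bz. *)
set (z := A * p / (B * D)) in *.
assert (EA : A = B * D * z / p) by (unfold z; field; repeat split; assumption).
assert (EB : A * p / B = D * z) by (unfold z; field; repeat split; assumption).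
assert (ED : A * p / D = B * z) by (unfold z; field; repeat split; assumption).
rewrite EB, ED in *. clearbody z.
rewrite Nat.mul_comm, Cpow_mult_r, Cpow_mult_l, !Cpow_S.
simpl qpoch. simpl qsign.
set (y := p ^ n) in *.
generalize dependent (qpoch A p n).
generalize dependent (qpoch (D * z) p n).
generalize dependent (qpoch (B * z) p n).
generalize dependent (qpoch p p n).
generalize (qpoch B p n) (qpoch D p n) (qsign p n) (z ^ n).
clearbody y.
intros b d s Z P HP V HV U HU a.
assert (HA2 : p - B * D * z <> 0).
{ intros H. apply HA0. rewrite EA.
  replace (1 - B * D * z / p) with ((p - B * D * z) / p) by (field; assumption).
  rewrite H. field. assumption. }
rewrite EA. simpl. field.
repeat split; assumption.
Qed.

Lemma Cmod_qsign_le (p : C) (n : nat) :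
  (Cmod p < 1)%R -> (Cmod (qsign p n) <= 1)%R.
Proof.
intros Hp. pose proof (Cmod_ge_0 p) as Hp0.
induction n as [|n IH]; simpl; [rewrite Cmod_1; lra|].
rewrite Cmod_mult, Cmod_opp, Cmod_pow.
pose proof (Cmod_ge_0 (qsign p n)).
assert (0 <= Cmod p ^ n <= 1)%R; [|nra].
split; [now apply pow_le|]. rewrite <- (pow1 n). apply pow_incr. lra.
Qed.

Lemma Cmod_one_minus_le (x : C) : (Cmod x <= 1)%R -> (Cmod (1 - x) <= 2)%R.
Proof.
intros Hx. eapply Rle_trans; [apply Cmod_triangle|].
rewrite Cmod_1, Cmod_opp. lra.
Qed.

Lemma Cmod_pow_le_1 (p : C) (n : nat) :
  (Cmod p < 1)%R -> (Cmod (p ^ n) <= 1)%R.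
Proof.
intros Hp. pose proof (Cmod_ge_0 p).
rewrite Cmod_pow, <- (pow1 n). apply pow_incr. lra.
Qed.

(** The constant K is uniform in A, B and D: later A runs through A p^n, and all three parameters
    vary with the outer summation index. *)
Lemma phi65_weight_bound (p : C) (beta t : R) :
  (Cmod p < 1)%R -> (t < 1)%R ->
  exists K : R, forall (A B D : C) (n : nat),
    (Cmod A <= 1)%R -> (Cmod B <= beta)%R -> (Cmod D <= beta)%R ->
    (Cmod (A * p / B) <= t)%R -> (Cmod (A * p / D) <= t)%R ->
    (Cmod (phi65_weight A B D p n) <= K * Cmod (A * p / (B * D)) ^ n)%R.
Proof.
intros Hp Ht.
set (N c := exp (c / (1 - Cmod p))).
set (L c := exp (c / (1 - c) / (1 - Cmod p))).
exists (N 1 * N beta * N beta * (L (Cmod p) * L t * L t))%R.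
intros A B D n HA HB HD Hu Hv.
unfold phi65_weight. rewrite Cmod_mult, Cmod_pow.
apply Rmult_le_compat_r; [apply pow_le, Cmod_ge_0|].
rewrite Cmod_mult.
rewrite <- (Rmult_1_r (N 1 * _ * _ * _)).
apply Rmult_le_compat; try apply Cmod_ge_0; [|now apply Cmod_qsign_le].
rewrite !Cmod_mult.
repeat (apply Rmult_le_compat; [apply Rmult_le_pos|apply Cmod_ge_0| |] ||
        apply Rmult_le_compat || apply Rmult_le_pos || apply Cmod_ge_0);
  solve [now apply Cmod_qpoch_le
        | apply Cmod_inv_qpoch_le; [exact Hp | lra]].
Qed.

Lemma phi65_term_bound (p : C) (beta t : R) :
  (Cmod p < 1)%R -> (t < 1)%R ->
  exists K : R, forall (A B D : C) (n : nat),
    (Cmod A <= 1)%R -> (Cmod B <= beta)%R -> (Cmod D <= beta)%R ->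
    (Cmod (A * p / B) <= t)%R -> (Cmod (A * p / D) <= t)%R ->
    (Cmod (phi65_term A B D p n) <= K * Cmod (A * p / (B * D)) ^ n)%R.
Proof.
intros Hp Ht. destruct (phi65_weight_bound p beta t Hp Ht) as [K HK].
exists (2 * K)%R. intros A B D n HA HB HD Hu Hv.
unfold phi65_term. rewrite Cmod_mult, Rmult_assoc.
apply Rmult_le_compat; try apply Cmod_ge_0; [|now apply HK].
apply Cmod_one_minus_le. rewrite Cmod_mult.
pose proof (Cmod_pow_le_1 p (2 * n) Hp).
pose proof (Cmod_ge_0 A). pose proof (Cmod_ge_0 (p ^ (2 * n))). nra.
Qed.

Lemma phi65_tele_sum (A B D p : C) (N : nat) :
  p <> 0 -> B <> 0 -> D <> 0 -> (Cmod p < 1)%R -> (Cmod A < 1)%R ->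
  (Cmod (A * p / B) < 1)%R -> (Cmod (A * p / D) < 1)%R ->
  (1 - A * p / B) * (1 - A * p / D) * sum_n (phi65_term A B D p) N
  - (1 - A) * (1 - A * p / (B * D)) * sum_n (phi65_term (A * p) B D p) N
  = phi65_tele A B D p (S N).
Proof.
intros Hp0 HB HD Hp HA Hu Hv.
assert (H : forall n, _) by
  (intros n; exact (phi65_term_contiguous A B D p n Hp0 HB HD Hp HA Hu Hv)).
induction N as [|N IH].
- rewrite !sum_O, H. unfold phi65_tele at 2. simpl. ring.
- rewrite !Csum_Sn.
  transitivity (phi65_tele A B D p (S N)
    + (phi65_tele A B D p (S (S N)) - phi65_tele A B D p (S N))); [|ring].
  rewrite <- H, <- IH. ring.
Qed.

Lemma phi65_sum_contiguous (A B D p T T' : C) :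
  p <> 0 -> B <> 0 -> D <> 0 -> (Cmod p < 1)%R -> (Cmod A < 1)%R ->
  (Cmod (A * p / B) < 1)%R -> (Cmod (A * p / D) < 1)%R ->
  (Cmod (A * p / (B * D)) < 1)%R ->
  is_series (phi65_term A B D p) T -> is_series (phi65_term (A * p) B D p) T' ->
  (1 - A * p / B) * (1 - A * p / D) * T = (1 - A) * (1 - A * p / (B * D)) * T'.
Proof.
intros Hp0 HB HD Hp HA Hu Hv Hz HT HT'.
destruct (phi65_weight_bound p (Rmax (Cmod B) (Cmod D))
  (Rmax (Cmod (A * p / B)) (Cmod (A * p / D)))) as [K HK];
  [exact Hp | now apply Rmax_lub_lt|].
assert (H0 : Clim (phi65_tele A B D p) (RtoC 0)).
(* Each of the three factors 1 - x of the certificate has modulus at most 2, and the weight decays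
   like |Ap/(BD)|^n. *)
{ apply Clim_Cmod_le with (fun n =>
    2 * 2 * 2 * K * Cmod (A * p / (B * D)) ^ n)%R;
    [|apply is_lim_seq_scal_geom; split; [apply Cmod_ge_0 | exact Hz]].
  intros n. replace (phi65_tele A B D p n - 0) with (phi65_tele A B D p n)
    by ring.
  unfold phi65_tele. rewrite !Cmod_mult, Cmod_opp, (Rmult_assoc (2 * 2 * 2) K).
  pose proof (Cmod_pow_le_1 p n Hp).
  repeat (apply Rmult_le_compat || apply Rmult_le_pos || apply Cmod_ge_0);
    try (apply Cmod_one_minus_le; lra).
  apply HK; try lra; first [apply Rmax_l | apply Rmax_r]. }
assert (H : Clim (fun N => phi65_tele A B D p (S N))
  ((1 - A * p / B) * (1 - A * p / D) * T
   + - ((1 - A) * (1 - A * p / (B * D))) * T')).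
{ apply Clim_ext with (fun N =>
    (1 - A * p / B) * (1 - A * p / D) * sum_n (phi65_term A B D p) N
    + - ((1 - A) * (1 - A * p / (B * D))) * sum_n (phi65_term (A * p) B D p) N).
  - intros N. rewrite <- phi65_tele_sum by assumption. ring.
  - apply Clim_plus; (apply Clim_mult; [apply Clim_const | assumption]). }
apply (Clim_shift _ _ 1) in H0.
pose proof (Clim_unique _ _ _ H H0) as E.
transitivity ((1 - A) * (1 - A * p / (B * D)) * T'
  + ((1 - A * p / B) * (1 - A * p / D) * T
     + - ((1 - A) * (1 - A * p / (B * D))) * T')); [ring|].
rewrite E. ring.
Qed.

Lemma phi65_sum (A B D p : C) :
  p <> 0 -> B <> 0 -> D <> 0 -> (Cmod p < 1)%R -> (Cmod A < 1)%R ->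
  (Cmod (A * p / B) < 1)%R -> (Cmod (A * p / D) < 1)%R ->
  (Cmod (A * p / (B * D)) < 1)%R ->
  is_series (phi65_term A B D p)
    (qpoch_inf A p * qpoch_inf (A * p / (B * D)) p
     / (qpoch_inf (A * p / B) p * qpoch_inf (A * p / D) p)).
Proof.
intros Hp0 HB HD Hp HA Hu Hv Hz.
set (z := A * p / (B * D)) in *. set (u := A * p / B) in *.
set (v := A * p / D) in *.
assert (Ez : forall n, A * p ^ n * p / (B * D) = z * p ^ n)
  by (intros n; unfold z; field; split; assumption).
assert (Eu : forall n, A * p ^ n * p / B = u * p ^ n)
  by (intros n; unfold u; field; assumption).
assert (Ev : forall n, A * p ^ n * p / D = v * p ^ n)
  by (intros n; unfold v; field; assumption).
assert (Hle : forall x n, (Cmod (x * p ^ n) <= Cmod x)%R).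
{ intros x n. rewrite Cmod_mult. pose proof (Cmod_pow_le_1 p n Hp).
  pose proof (Cmod_ge_0 x). nra. }
destruct (phi65_term_bound p (Rmax (Cmod B) (Cmod D))
  (Rmax (Cmod u) (Cmod v))) as [K HK]; [exact Hp | now apply Rmax_lub_lt|].
assert (Hterm : forall n m, (Cmod (phi65_term (A * p ^ n) B D p m)
  <= K * Cmod (z * p ^ n) ^ m)%R).
{ intros n m. rewrite <- Ez. apply HK.
  - pose proof (Hle A n). lra.
  - apply Rmax_l.
  - apply Rmax_r.
  - rewrite Eu. eapply Rle_trans; [apply Hle | apply Rmax_l].
  - rewrite Ev. eapply Rle_trans; [apply Hle | apply Rmax_r]. }
set (T n := CSeries (phi65_term (A * p ^ n) B D p)).
(* The term of index 0 is 1 - A p^n and the ratio of the geometric bound is |z p^n|, so the rest of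
   the series is of order |p|^n; hence [T n] tends to 1. *)
assert (HT : forall n, is_series (phi65_term (A * p ^ n) B D p) (T n) /\
  (Cmod (T n - (1 - A * p ^ n)) <= K / (1 - Cmod z) * (Cmod z * Cmod p ^ n))%R).
{ intros n.
  destruct (is_series_geom_bound _ K (Cmod (z * p ^ n)) (conj (Cmod_ge_0 _)
    (Cmod_mult_pow_lt_1 z p n Hp Hz)) (Hterm n)) as [l [Hl Hb]].
  unfold T. rewrite (CSeries_unique _ _ Hl). split; [exact Hl|].
  specialize (Hb 0%nat). rewrite sum_O in Hb.
  replace (phi65_term (A * p ^ n) B D p 0) with (1 - A * p ^ n) in Hb.
  2:{ unfold phi65_term, phi65_weight. simpl. field. }
  eapply Rle_trans; [exact Hb|]. rewrite pow_1, <- Cmod_pow, <- Cmod_mult.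
  apply Rmult_le_compat_r; [apply Cmod_ge_0|].
  pose proof (Hle z n).
  apply Rmult_le_compat_l; [|apply Rinv_le_contravar; lra].
  pose proof (Hterm 0%nat 0%nat) as H0. simpl in H0.
  pose proof (Cmod_ge_0 (phi65_term (A * 1) B D p 0)). lra. }
assert (Hrec : forall n, qpoch u p n * qpoch v p n * T 0%nat
  = qpoch A p n * qpoch z p n * T n).
{ induction n as [|n IH]; simpl.
  - ring.
  - transitivity ((1 - u * p ^ n) * (1 - v * p ^ n)
      * (qpoch u p n * qpoch v p n * T 0%nat)); [ring|].
    rewrite IH.
    assert (E : (1 - u * p ^ n) * (1 - v * p ^ n) * T n
      = (1 - A * p ^ n) * (1 - z * p ^ n) * T (S n)).
    { rewrite <- Eu, <- Ev, <- Ez.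
      apply phi65_sum_contiguous; try assumption.
      - now apply Cmod_mult_pow_lt_1.
      - rewrite Eu. now apply Cmod_mult_pow_lt_1.
      - rewrite Ev. now apply Cmod_mult_pow_lt_1.
      - rewrite Ez. now apply Cmod_mult_pow_lt_1.
      - apply HT.
      - replace (A * p ^ n * p) with (A * p ^ S n) by (simpl; ring).
        apply HT. }
    transitivity (qpoch A p n * qpoch z p n
      * ((1 - u * p ^ n) * (1 - v * p ^ n) * T n)); [ring|].
    rewrite E. ring. }
assert (HT1 : Clim T (RtoC 1)).
{ apply Clim_Cmod_le with (fun n =>
    (K / (1 - Cmod z) * Cmod z + Cmod A) * Cmod p ^ n)%R;
    [|apply is_lim_seq_scal_geom; split; [apply Cmod_ge_0 | exact Hp]].
  intros n. replace (T n - 1) with (T n - (1 - A * p ^ n) + - (A * p ^ n))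
    by ring.
  eapply Rle_trans; [apply Cmod_triangle|].
  rewrite Cmod_opp, Cmod_mult, Cmod_pow.
  pose proof (proj2 (HT n)). lra. }
(* Both sides are the limit of one sequence, written in the two ways that [Hrec] equates. *)
assert (E : qpoch_inf u p * qpoch_inf v p * T 0%nat
  = qpoch_inf A p * qpoch_inf z p * 1).
{ apply Clim_unique with (fun n => qpoch u p n * qpoch v p n * T 0%nat).
  - apply Clim_mult; [|apply Clim_const].
    apply Clim_mult; now apply Clim_qpoch.
  - apply Clim_ext with (fun n => qpoch A p n * qpoch z p n * T n);
      [now intros n|].
    apply Clim_mult; [|exact HT1].
    apply Clim_mult; now apply Clim_qpoch. }
pose proof (qpoch_inf_neq_0 u p Hp Hu). pose proof (qpoch_inf_neq_0 v p Hp Hv).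
replace (qpoch_inf A p * qpoch_inf z p / (qpoch_inf u p * qpoch_inf v p))
  with (T 0%nat).
- destruct (HT 0%nat) as [H1 _]. simpl (p ^ 0) in H1.
  now rewrite Cmult_1_r in H1.
- rewrite Cmult_1_r in E. rewrite <- E. field. now split.
Qed.

(** * The Bailey pair *)

(* Up to a factor depending only on $r$, [hecke_coef q j (r - j)] is the
   $\beta_j$-term of $\alpha_r$ in the inverted Bailey relation. *)
Definition hecke_coef (q : C) (j d : nat) : C :=
  qpoch (q ^ 2) (q ^ 2) (2 * j + d) * qsign (q ^ 2) d
  / (qpoch (q ^ 2) (q ^ 2) d
     * (qpoch (- q ^ 2) (q ^ 2) j * qpoch (- q ^ 3) (q ^ 2) j)).

(* The telescoping certificate of [hecke_diff], shifted by one in [j] and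
   simplified, so that it needs no value at a negative index. *)
Definition hecke_tele (q : C) (j d : nat) : C :=
  - ((q ^ 2) ^ d * (1 - (q ^ 2) ^ (j + d + 1))
     * qpoch (q ^ 2) (q ^ 2) (2 * j + 1 + d) * qsign (q ^ 2) d
     / (qpoch (q ^ 2) (q ^ 2) d
        * (qpoch (- q ^ 2) (q ^ 2) j * qpoch (- q ^ 3) (q ^ 2) j))).

(** The share of index j in a recurrence from row r to row r+1. Here d stands for r - j, passed
    separately so that no truncated subtraction enters the algebra. *)
Definition hecke_diff (q : C) (r j d : nat) : C :=
  (1 + q ^ 3 * (q ^ 2) ^ r) * hecke_coef q j (S d)
  - q ^ 3 * (q ^ 2) ^ (2 * r) * (1 + q * (q ^ 2) ^ r) * hecke_coef q j d.

Lemma Cmod_pow_lt_1 (q : C) (n : nat) :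
  (Cmod q < 1)%R -> (Cmod (q ^ S n) < 1)%R.
Proof. intros Hq. simpl. now apply Cmod_mult_pow_lt_1. Qed.

(** At j = 0 no earlier certificate is subtracted. What is left over is the inhomogeneous term of
    the recurrence: 1 + q times the two outermost terms of the theta-like sum of index d+1. *)
Lemma hecke_diff_O (q : C) (d : nat) :
  (Cmod q < 1)%R ->
  hecke_diff q d 0 d
  = hecke_tele q 0 d + 2 * (1 + q) * (q ^ 2) ^ S d * qsign (q ^ 2) (S d).
Proof.
intros Hq.
pose proof (Cmod_pow_lt_1 q 1 Hq) as Hp.
unfold hecke_diff, hecke_tele, hecke_coef.
rewrite !Nat.mul_0_r, !Nat.add_0_l, (Nat.add_1_r d).
simpl (1 + d)%nat. replace (2 * d)%nat with (d + d)%nat by lia.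
remember (q ^ 2) as p eqn:Ep. remember (q ^ 3) as c eqn:Ec.
simpl qpoch. simpl qsign.
pose proof (qpoch_neq_0 _ _ d Hp Hp) as H0.
pose proof (Cmod_lt_1_neq _ (Cmod_mult_pow_lt_1 _ _ d Hp Hp)) as H1.
rewrite Cpow_add_r, !(Cpow_S p d).
generalize dependent (qpoch p p d). intros P HP.
generalize dependent (p ^ d). intros Y H1.
subst p c. field. split; assumption.
Qed.

Lemma hecke_diff_S (q : C) (j d : nat) :
  (Cmod q < 1)%R ->
  hecke_diff q (S j + d) (S j) d = hecke_tele q (S j) d - hecke_tele q j (S d).
Proof.
intros Hq.
pose proof (Cmod_pow_lt_1 q 1 Hq) as Hp.
pose proof (Cmod_pow_lt_1 q 2 Hq) as Hr.
assert (Hp' : (Cmod (- q ^ 2) < 1)%R) by now rewrite Cmod_opp.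
assert (Hr' : (Cmod (- q ^ 3) < 1)%R) by now rewrite Cmod_opp.
unfold hecke_diff, hecke_tele, hecke_coef.
(* The indices are brought to visible successors, so that unfolding leaves (p;p)_{2j+d} as a common
   factor. *)
replace (2 * (S j + d))%nat with (S (S (j + j + d + d)))%nat by lia.
replace (2 * S j + S d)%nat with (S (S (S (j + j + d))))%nat by lia.
replace (2 * S j + d)%nat with (S (S (j + j + d)))%nat by lia.
replace (S j + d)%nat with (S (j + d))%nat by lia.
replace (S (j + d) + 1)%nat with (S (S (j + d)))%nat by lia.
replace (2 * S j + 1 + d)%nat with (S (S (S (j + j + d))))%nat by lia.
replace (j + S d + 1)%nat with (S (S (j + d)))%nat by lia.
replace (2 * j + 1 + S d)%nat with (S (S (j + j + d)))%nat by lia.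
remember (q ^ 2) as p eqn:Ep. remember (q ^ 3) as c eqn:Ec.
simpl qpoch. simpl qsign.
pose proof (qpoch_neq_0 _ _ d Hp Hp) as H0.
pose proof (Cmod_lt_1_neq _ (Cmod_mult_pow_lt_1 _ _ d Hp Hp)) as H1.
pose proof (qpoch_neq_0 _ _ j Hp Hp') as H2.
pose proof (qpoch_neq_0 _ _ j Hp Hr') as H3.
pose proof (Cmod_lt_1_neq _ (Cmod_mult_pow_lt_1 _ _ j Hp Hp')) as H4.
pose proof (Cmod_lt_1_neq _ (Cmod_mult_pow_lt_1 _ _ j Hp Hr')) as H5.
rewrite !(Cpow_S p), !(Cpow_add_r p).
generalize dependent (qpoch p p d). intros P HP.
generalize dependent (qpoch (- p) p j). intros P2 HP2.
generalize dependent (qpoch (- c) p j). intros P3 HP3.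
generalize (qpoch p p (j + j + d)) (qsign p d).
intros Q s.
generalize dependent (p ^ d). intros V H1.
generalize dependent (p ^ j). intros Y H4 H5.
subst p c. field. repeat split; assumption.
Qed.

(** The row r = J + d stays fixed while the range of j grows, so the induction on J uses its
    hypothesis at d+1. *)
Lemma hecke_diff_sum (q : C) (J d : nat) :
  (Cmod q < 1)%R ->
  sum_n (fun j => hecke_diff q (J + d) j (J + d - j)) J
  = hecke_tele q J d
    + 2 * (1 + q) * (q ^ 2) ^ S (J + d) * qsign (q ^ 2) (S (J + d)) :> C.
Proof.
intros Hq. revert d. induction J as [|J IH]; intros d.
- rewrite sum_O, Nat.sub_0_r. now apply hecke_diff_O.
- rewrite Csum_Sn. replace (S J + d - S J)%nat with d by lia.
  rewrite hecke_diff_S by exact Hq.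
  specialize (IH (S d)). replace (J + S d)%nat with (S J + d)%nat in IH by lia.
  rewrite IH. ring.
Qed.

Lemma sum_n_Cmult_l (c : C) (u : nat -> C) (N : nat) :
  sum_n (fun n => c * u n) N = c * sum_n u N :> C.
Proof. exact (sum_n_mult_l (K := C_Ring) c u N). Qed.

Lemma hecke_coef_sum_S (q : C) (r : nat) :
  (Cmod q < 1)%R ->
  (1 + q ^ 3 * (q ^ 2) ^ r) * sum_n (fun j => hecke_coef q j (S r - j)) (S r)
  = q ^ 3 * (q ^ 2) ^ (2 * r) * (1 + q * (q ^ 2) ^ r)
    * sum_n (fun j => hecke_coef q j (r - j)) r
    + 2 * (1 + q) * (q ^ 2) ^ S r * qsign (q ^ 2) (S r).
Proof.
intros Hq.
pose proof (hecke_diff_sum q r 0 Hq) as H. rewrite Nat.add_0_r in H.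
rewrite (sum_n_ext_loc _ (fun j =>
  (1 + q ^ 3 * (q ^ 2) ^ r) * hecke_coef q j (S r - j)
  - q ^ 3 * (q ^ 2) ^ (2 * r) * (1 + q * (q ^ 2) ^ r) * hecke_coef q j (r - j)))
  in H.
2:{ intros j Hj. unfold hecke_diff. now rewrite Nat.sub_succ_l. }
rewrite sum_n_Cminus, !sum_n_Cmult_l in H.
(* The term j = r+1 of the new row has no partner in row r; it cancels exactly the upper boundary of
   the telescoping sum. *)
assert (Hlast : (1 + q ^ 3 * (q ^ 2) ^ r) * hecke_coef q (S r) 0
  = - hecke_tele q r 0).
{ pose proof (Cmod_pow_lt_1 q 1 Hq) as Hp.
  pose proof (Cmod_pow_lt_1 q 2 Hq) as Hr.
  assert (Hp' : (Cmod (- q ^ 2) < 1)%R) by now rewrite Cmod_opp.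
  assert (Hr' : (Cmod (- q ^ 3) < 1)%R) by now rewrite Cmod_opp.
  unfold hecke_tele, hecke_coef.
  replace (2 * S r + 0)%nat with (S (S (r + r))) by lia.
  replace (2 * r + 1 + 0)%nat with (S (r + r)) by lia.
  replace (r + 0 + 1)%nat with (S r) by lia.
  remember (q ^ 2) as p eqn:Ep. remember (q ^ 3) as c eqn:Ec.
  simpl qpoch.
  pose proof (qpoch_neq_0 _ _ r Hp Hp') as H2.
  pose proof (qpoch_neq_0 _ _ r Hp Hr') as H3.
  pose proof (Cmod_lt_1_neq _ (Cmod_mult_pow_lt_1 _ _ r Hp Hp')) as H4.
  pose proof (Cmod_lt_1_neq _ (Cmod_mult_pow_lt_1 _ _ r Hp Hr')) as H5.
  clear H. rewrite !(Cpow_S p), !(Cpow_add_r p).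
  generalize dependent (qpoch (- p) p r). intros P2 HP2.
  generalize dependent (qpoch (- c) p r). intros P3 HP3.
  generalize (qpoch p p (r + r)). intros Q.
  generalize dependent (p ^ r). intros Y H4 H5.
  subst p c. field. repeat split; assumption. }
rewrite Csum_Sn, Nat.sub_diag, Cmult_plus_distr_l, Hlast.
match type of H with ?a - ?b = _ => replace a with (a - b + b) by ring end.
rewrite H. ring.
Qed.

(** * Finite theta-like sums and their recurrence *)

Definition theta_term (q : C) (n : nat) : C :=
  sum_sym (fun j : Z =>
    CpowZ (-1) j * CpowZ q (2 * Z.of_nat n ^ 2 + Z.of_nat n - j ^ 2)) n.

Lemma sum_sym_S (f : Z -> C) (n : nat) :
  sum_sym f (S n)
  = sum_sym f n + f (Z.of_nat (S n)) + f (- Z.of_nat (S n))%Z.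
Proof.
unfold sum_sym. replace (2 * S n)%nat with (S (S (2 * n))) by lia.
unfold sum_n. rewrite sum_n_Sm by lia. rewrite sum_Sn_m by lia.
rewrite <- sum_n_m_S.
replace (Z.of_nat (S (S (2 * n))) - Z.of_nat (S n))%Z
  with (Z.of_nat (S n)) by lia.
replace (Z.of_nat 0 - Z.of_nat (S n))%Z with (- Z.of_nat (S n))%Z by lia.
rewrite (sum_n_m_ext _ (fun i => f (Z.of_nat i - Z.of_nat n)%Z)).
2:{ intros i. f_equal. lia. }
change plus with Cplus. ring.
Qed.

Lemma sum_sym_ext (f g : Z -> C) (n : nat) :
  (forall j, (Z.abs j <= Z.of_nat n)%Z -> f j = g j) ->
  sum_sym f n = sum_sym g n.
Proof.
intros H. apply sum_n_ext_loc. intros i Hi. apply H. lia.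
Qed.

Lemma sum_sym_mult_l (c : C) (f : Z -> C) (n : nat) :
  sum_sym (fun j => c * f j) n = c * sum_sym f n.
Proof. apply sum_n_Cmult_l. Qed.

Lemma CpowZ_of_nat (z : C) (n : nat) : CpowZ z (Z.of_nat n) = z ^ n.
Proof. destruct n as [|n]; [easy|]. simpl. now rewrite SuccNat2Pos.id_succ. Qed.

Lemma CpowZ_add_nat (z : C) (k : Z) (n : nat) :
  (0 <= k)%Z -> CpowZ z (k + Z.of_nat n) = z ^ n * CpowZ z k.
Proof.
intros Hk. rewrite <- (Z2Nat.id k Hk), <- Nat2Z.inj_add, !CpowZ_of_nat.
rewrite Cpow_add_r. ring.
Qed.

Lemma CpowZ_m1 (n : nat) :
  CpowZ (-1) (Z.of_nat n) = (-1) ^ n /\ CpowZ (-1) (- Z.of_nat n) = (-1) ^ n.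
Proof.
split; [apply CpowZ_of_nat|].
assert (H : (-1) ^ n * (-1) ^ n = 1).
{ rewrite <- Cpow_mult_l. replace (-1 * -1) with (RtoC 1) by ring.
  apply Cpow_1_l. }
destruct n as [|n]; [easy|]. simpl CpowZ.
rewrite SuccNat2Pos.id_succ.
assert (Hn : (-1) ^ S n <> 0).
{ intros H0. rewrite H0, Cmult_0_l in H. now apply C1_nz. }
rewrite <- (Cmult_1_r (/ _)), <- H. field. exact Hn.
Qed.

(** Since [qsign (q ^ 2) n] is (-1)^n q^(n^2-n), the extra q^(2n) gives the terms j = n and j = -n
    of [theta_term], with a natural exponent. *)
Lemma qsign_square (q : C) (n : nat) :
  (q ^ 2) ^ n * qsign (q ^ 2) n = (-1) ^ n * q ^ (n * n + n).
Proof.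
induction n as [|n IH]; [simpl; ring|].
change (qsign (q ^ 2) (S n)) with (qsign (q ^ 2) n * - (q ^ 2) ^ n).
replace (S n * S n + S n)%nat with (n * n + n + 2 * S n)%nat by lia.
rewrite Cpow_add_r, Cpow_mult_r, (Cpow_S (-1)).
transitivity (- (q ^ 2) ^ S n * ((q ^ 2) ^ n * qsign (q ^ 2) n)); [ring|].
rewrite IH. ring.
Qed.

(** The exponent 2n^2+n grows by 4n+3, uniformly in j, and the new terms j = n+1 and j = -(n+1)
    coincide. *)
Lemma theta_term_S (q : C) (n : nat) :
  theta_term q (S n)
  = q ^ (4 * n + 3) * theta_term q n
    + 2 * ((q ^ 2) ^ S n * qsign (q ^ 2) (S n)).
Proof.
unfold theta_term. rewrite sum_sym_S.
rewrite (proj1 (CpowZ_m1 (S n))), (proj2 (CpowZ_m1 (S n))), qsign_square.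
replace (2 * Z.of_nat (S n) ^ 2 + Z.of_nat (S n) - (- Z.of_nat (S n)) ^ 2)%Z
  with (2 * Z.of_nat (S n) ^ 2 + Z.of_nat (S n) - Z.of_nat (S n) ^ 2)%Z by ring.
replace (2 * Z.of_nat (S n) ^ 2 + Z.of_nat (S n) - Z.of_nat (S n) ^ 2)%Z
  with (Z.of_nat (S n * S n + S n)) by lia.
rewrite CpowZ_of_nat, <- sum_sym_mult_l.
rewrite (sum_sym_ext _ (fun j => q ^ (4 * n + 3) * (CpowZ (-1) j
  * CpowZ q (2 * Z.of_nat n ^ 2 + Z.of_nat n - j ^ 2)))); [ring|].
intros j Hj.
replace (2 * Z.of_nat (S n) ^ 2 + Z.of_nat (S n) - j ^ 2)%Z
  with (2 * Z.of_nat n ^ 2 + Z.of_nat n - j ^ 2 + Z.of_nat (4 * n + 3))%Z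
  by lia.
rewrite CpowZ_add_nat by nia. ring.
Qed.

(** Both sides equal 1 + q at n = 0 and obey the same first-order recurrence; with p = q^2, the
    factor 1 + q^3 p^n in [hecke_coef_sum_S] is 1 + q p^(n+1). *)
Lemma theta_term_eq (q : C) (n : nat) :
  (Cmod q < 1)%R ->
  (1 + q) * theta_term q n
  = (1 + q * (q ^ 2) ^ n) * sum_n (fun j => hecke_coef q j (n - j)) n.
Proof.
intros Hq. induction n as [|n IH].
- unfold theta_term, sum_sym, hecke_coef. rewrite !sum_O. simpl.
  field.
- replace (q * (q ^ 2) ^ S n) with (q ^ 3 * (q ^ 2) ^ n) by (simpl; ring).
  rewrite hecke_coef_sum_S by exact Hq.
  rewrite theta_term_S, Cpow_add_r.
  replace (4 * n)%nat with (2 * (2 * n))%nat by lia.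
  rewrite (Cpow_mult_r q 2 (2 * n)).
  transitivity (q ^ 3 * (q ^ 2) ^ (2 * n) * ((1 + q) * theta_term q n)
    + 2 * (1 + q) * (q ^ 2) ^ S n * qsign (q ^ 2) (S n)); [ring|].
  rewrite IH. ring.
Qed.

(** * Interchange of summations *)

Definition poised_ratio (q a b : C) (n : nat) : C :=
  (qpoch (q ^ 2 / a) (q ^ 2) n * qpoch (q ^ 2 / b) (q ^ 2) n)
  / (qpoch (a * q ^ 2) (q ^ 2) n * qpoch (b * q ^ 2) (q ^ 2) n) * (a * b) ^ n.

Lemma hecke_term_eq (q a b : C) (n : nat) :
  hecke_term q a b n
  = (1 - q * (q ^ 2) ^ n) * poised_ratio q a b n * theta_term q n.
Proof.
unfold hecke_term, theta_term, poised_ratio.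
rewrite <- sum_sym_mult_l. apply sum_sym_ext. intros j _.
rewrite (Nat.add_1_r (2 * n)), Cpow_S, Cpow_mult_r.
unfold Cdiv. ring.
Qed.

(** The part free of m once the shifted factorials are split: with p = q^2, (p;p)_{2j+m} leaves
    (p;p)_{2j} here, and the factors depending on m form the 6phi5 term. *)
Definition swap_coef (q a b : C) (j : nat) : C :=
  qpoch (q ^ 2) (q ^ 2) (2 * j) * poised_ratio q a b j
  / (qpoch (- q ^ 2) (q ^ 2) j * qpoch (- q ^ 3) (q ^ 2) j).

Definition swap_term (q a b : C) (j m : nat) : C :=
  swap_coef q a b j
  * phi65_term (q ^ 2 * (q ^ 2) ^ (2 * j)) (q ^ 2 / a * (q ^ 2) ^ j)
      (q ^ 2 / b * (q ^ 2) ^ j) (q ^ 2) m.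

Section InterchangeOfSums.

Variables q a b : C.
Hypotheses (Hq0 : q <> 0) (Ha : a <> 0) (Hb : b <> 0) (Hq : (Cmod q < 1)%R)
  (Hab : (Cmod (a * b) < 1)%R) (Haq : (Cmod (a * q ^ 2) < 1)%R)
  (Hbq : (Cmod (b * q ^ 2) < 1)%R).

Let p := q ^ 2.

Lemma base_lt_1 : (Cmod p < 1)%R.
Proof. exact (Cmod_pow_lt_1 q 1 Hq). Qed.

Lemma base_neq_0 : p <> 0.
Proof. now apply Cpow_nz. Qed.

Lemma opp_base_lt_1 : (Cmod (- p) < 1)%R.
Proof. rewrite Cmod_opp. apply base_lt_1. Qed.

Lemma opp_cube_lt_1 : (Cmod (- q ^ 3) < 1)%R.
Proof. rewrite Cmod_opp. exact (Cmod_pow_lt_1 q 2 Hq). Qed.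

(** For A = p^(2j+1), B = p^(j+1)/a, D = p^(j+1)/b, this and the next two lemmas evaluate Ap/B, Ap/D
    and Ap/(BD). The last is independent of j. *)
Lemma poised_u (j : nat) :
  p * p ^ (2 * j) * p / (p / a * p ^ j) = a * p * p ^ j.
Proof.
replace (2 * j)%nat with (j + j)%nat by lia. rewrite Cpow_add_r.
pose proof base_neq_0 as Hp0. pose proof (Cpow_nz p j Hp0) as Hj.
field. now repeat split.
Qed.

Lemma poised_v (j : nat) :
  p * p ^ (2 * j) * p / (p / b * p ^ j) = b * p * p ^ j.
Proof.
replace (2 * j)%nat with (j + j)%nat by lia. rewrite Cpow_add_r.
pose proof base_neq_0 as Hp0. pose proof (Cpow_nz p j Hp0) as Hj.
field. now repeat split.
Qed.

Lemma poised_z (j : nat) :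
  p * p ^ (2 * j) * p / (p / a * p ^ j * (p / b * p ^ j)) = a * b.
Proof.
replace (2 * j)%nat with (j + j)%nat by lia. rewrite Cpow_add_r.
pose proof base_neq_0 as Hp0. pose proof (Cpow_nz p j Hp0) as Hj.
field. now repeat split.
Qed.

Lemma swap_term_eq (j m : nat) :
  swap_term q a b j m
  = (1 - p ^ (2 * (j + m) + 1)) * poised_ratio q a b (j + m)
    * hecke_coef q j m.
Proof.
pose proof base_lt_1 as Hp.
unfold swap_term, swap_coef, phi65_term, phi65_weight, poised_ratio,
  hecke_coef. fold p. rewrite poised_u, poised_v, poised_z.
replace (2 * (j + m) + 1)%nat with (1 + 2 * j + 2 * m)%nat by lia.
rewrite !qpoch_add, !Cpow_add_r, Cpow_1_r.
pose proof (qpoch_neq_0 _ _ m Hp Hp).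
pose proof (qpoch_neq_0 _ _ j Hp opp_base_lt_1).
pose proof (qpoch_neq_0 _ _ j Hp opp_cube_lt_1).
pose proof (qpoch_neq_0 _ _ j Hp Haq).
pose proof (qpoch_neq_0 _ _ j Hp Hbq).
pose proof (qpoch_neq_0 _ _ m Hp (Cmod_mult_pow_lt_1 _ _ j Hp Haq)).
pose proof (qpoch_neq_0 _ _ m Hp (Cmod_mult_pow_lt_1 _ _ j Hp Hbq)).
field. repeat split; assumption.
Qed.

(** The very-well-poised factor splits as 1 - p^(2n+1) = (1 - q p^n)(1 + q p^n): the first factor
    belongs to the Hecke-type term, the second is absorbed by [theta_term_eq]. *)
Lemma swap_term_sum (n : nat) :
  sum_n (fun j => swap_term q a b j (n - j)) n
  = (1 + q) * hecke_term q a b n :> C.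
Proof.
rewrite hecke_term_eq.
transitivity ((1 - p ^ (2 * n + 1)) * poised_ratio q a b n
  * sum_n (fun j => hecke_coef q j (n - j)) n).
- rewrite <- sum_n_Cmult_l. apply sum_n_ext_loc. intros j Hj.
  rewrite swap_term_eq. now replace (j + (n - j))%nat with n by lia.
- transitivity ((1 - q * p ^ n) * poised_ratio q a b n
    * ((1 + q) * theta_term q n)); [|fold p; ring].
  rewrite theta_term_eq by exact Hq. fold p.
  replace (2 * n + 1)%nat with (n + n + 1)%nat by lia.
  rewrite !Cpow_add_r, Cpow_1_r. unfold p at 3. ring.
Qed.

Definition prefactor : C :=
  (qpoch_inf p p * qpoch_inf (a * b) p)
  / (qpoch_inf (a * p) p * qpoch_inf (b * p) p).

Lemma swap_term_is_series (j : nat) :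
  is_series (swap_term q a b j)
    (prefactor * phi32_term (p / a) (p / b) p (- p) (- q ^ 3) p (a * b) j).
Proof.
pose proof base_lt_1 as Hp. pose proof base_neq_0 as Hp0.
assert (Hne : forall x : C, x <> 0 -> p / x * p ^ j <> 0).
{ intros x Hx H. apply (Cpow_nz p (S j) Hp0).
  replace (p ^ S j) with (x * (p / x * p ^ j))
    by (rewrite Cpow_S; field; exact Hx).
  rewrite H. ring. }
assert (H := phi65_sum (p * p ^ (2 * j)) (p / a * p ^ j) (p / b * p ^ j) p
  Hp0 (Hne a Ha) (Hne b Hb) Hp).
rewrite poised_u, poised_v, poised_z in H.
specialize (H (Cmod_mult_pow_lt_1 _ _ _ Hp Hp)
  (Cmod_mult_pow_lt_1 _ _ _ Hp Haq) (Cmod_mult_pow_lt_1 _ _ _ Hp Hbq) Hab).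
apply (is_series_C_scal (swap_coef q a b j)) in H.
match type of H with is_series _ ?l =>
  replace (prefactor * _) with l; [exact H|] end.
unfold prefactor, swap_coef, poised_ratio, phi32_term. fold p.
(* Once split, the prefactor shares its shifted infinite products with the 6phi5 value; the finite
   factors split off are those already in [swap_coef]. *)
rewrite (qpoch_inf_split p p (2 * j)), (qpoch_inf_split (a * p) p j),
  (qpoch_inf_split (b * p) p j) by exact Hp.
pose proof (qpoch_neq_0 _ _ j Hp Hp).
pose proof (qpoch_neq_0 _ _ j Hp opp_base_lt_1).
pose proof (qpoch_neq_0 _ _ j Hp opp_cube_lt_1).
pose proof (qpoch_neq_0 _ _ j Hp Haq).
pose proof (qpoch_neq_0 _ _ j Hp Hbq).
pose proof (qpoch_inf_neq_0 _ _ Hp (Cmod_mult_pow_lt_1 _ _ j Hp Haq)).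
pose proof (qpoch_inf_neq_0 _ _ Hp (Cmod_mult_pow_lt_1 _ _ j Hp Hbq)).
field. repeat split; assumption.
Qed.

Lemma Cmod_product_le (u v : C) (k l : R) :
  (Cmod u <= k)%R -> (Cmod v <= l)%R -> (Cmod (u * v) <= k * l)%R.
Proof.
intros Hu Hv. rewrite Cmod_mult.
apply Rmult_le_compat; try apply Cmod_ge_0; assumption.
Qed.

Lemma swap_coef_bound :
  exists K, forall j, (Cmod (swap_coef q a b j) <= K * Cmod (a * b) ^ j)%R.
Proof.
pose proof base_lt_1 as Hp.
(* The constant is filled in by unification with the product of the bounds of the single factors,
   none of which depends on [j]. *)
eexists. intros j.
replace (swap_coef q a b j) with
  (qpoch p p (2 * j) * (qpoch (p / a) p j * (qpoch (p / b) p j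
   * (/ qpoch (a * p) p j * (/ qpoch (b * p) p j
   * (/ qpoch (- p) p j * / qpoch (- q ^ 3) p j))))) * (a * b) ^ j).
- rewrite Cmod_mult, Cmod_pow.
  apply Rmult_le_compat_r; [apply pow_le, Cmod_ge_0|].
  repeat apply Cmod_product_le;
    first [ apply Cmod_qpoch_le; [exact Hp | apply Rle_refl]
          | apply Cmod_inv_qpoch_le; [exact Hp | split; [apply Rle_refl|]] ];
    [exact Haq | exact Hbq | exact opp_base_lt_1 | exact opp_cube_lt_1].
- unfold swap_coef, poised_ratio. fold p.
  pose proof (qpoch_neq_0 _ _ j Hp opp_base_lt_1).
  pose proof (qpoch_neq_0 _ _ j Hp opp_cube_lt_1).
  pose proof (qpoch_neq_0 _ _ j Hp Haq).
  pose proof (qpoch_neq_0 _ _ j Hp Hbq).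
  field. repeat split; assumption.
Qed.

Lemma swap_term_bound :
  exists K, forall j m,
    (Cmod (swap_term q a b j m) <= K * Cmod (a * b) ^ (j + m))%R.
Proof.
pose proof base_lt_1 as Hp.
destruct swap_coef_bound as [K1 HK1].
destruct (phi65_term_bound p (Rmax (Cmod (p / a)) (Cmod (p / b)))
  (Rmax (Cmod (a * p)) (Cmod (b * p)))) as [K2 HK2];
  [exact Hp | now apply Rmax_lub_lt|].
exists (K1 * K2)%R. intros j m.
assert (Hle : forall x n, (Cmod (x * p ^ n) <= Cmod x)%R).
{ intros x n. rewrite Cmod_mult. pose proof (Cmod_pow_le_1 p n Hp).
  pose proof (Cmod_ge_0 x). nra. }
replace (K1 * K2 * Cmod (a * b) ^ (j + m))%R
  with (K1 * Cmod (a * b) ^ j * (K2 * Cmod (a * b) ^ m))%R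
  by (rewrite pow_add; ring).
apply Cmod_product_le; [apply HK1|]. fold p.
(* Every inner series has the same argument ab, so one constant and one ratio serve all rows. *)
rewrite <- (poised_z j) at 1. apply HK2.
- eapply Rle_trans; [apply Hle | lra].
- eapply Rle_trans; [apply Hle | apply Rmax_l].
- eapply Rle_trans; [apply Hle | apply Rmax_r].
- rewrite poised_u. eapply Rle_trans; [apply Hle | apply Rmax_l].
- rewrite poised_v. eapply Rle_trans; [apply Hle | apply Rmax_r].
Qed.

Lemma phi32_is_series :
  exists l : C,
    is_series (phi32_term (p / a) (p / b) p (- p) (- q ^ 3) p (a * b)) l.
Proof.
pose proof base_lt_1 as Hp.
assert (HK : exists K, forall j,
  (Cmod (phi32_term (p / a) (p / b) p (- p) (- q ^ 3) p (a * b) j)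
   <= K * Cmod (a * b) ^ j)%R).
{ eexists. intros j.
  (* The third upper parameter is the base itself, so its factorial cancels (p;p)_j. *)
  replace (phi32_term (p / a) (p / b) p (- p) (- q ^ 3) p (a * b) j) with
    (qpoch (p / a) p j * (qpoch (p / b) p j
     * (/ qpoch (- p) p j * / qpoch (- q ^ 3) p j)) * (a * b) ^ j).
  - rewrite Cmod_mult, Cmod_pow.
    apply Rmult_le_compat_r; [apply pow_le, Cmod_ge_0|].
    repeat apply Cmod_product_le;
      first [ apply Cmod_qpoch_le; [exact Hp | apply Rle_refl]
            | apply Cmod_inv_qpoch_le; [exact Hp | split; [apply Rle_refl|]] ];
      [exact opp_base_lt_1 | exact opp_cube_lt_1].
  - unfold phi32_term.
    pose proof (qpoch_neq_0 _ _ j Hp Hp).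
    pose proof (qpoch_neq_0 _ _ j Hp opp_base_lt_1).
    pose proof (qpoch_neq_0 _ _ j Hp opp_cube_lt_1).
    field. repeat split; assumption. }
destruct HK as [K HK].
destruct (is_series_geom_bound _ K _ (conj (Cmod_ge_0 _) Hab) HK)
  as [l [Hl _]].
now exists l.
Qed.

End InterchangeOfSums.

(** Convergence of both series is asserted beside the identity, since [CSeries] is unspecified on
    divergent series. *)
Theorem theorem3p10 (q a b : C) :
  q <> 0 -> a <> 0 -> b <> 0 ->
  (Cmod q < 1)%R ->
  (Rmax (Cmod (a * b)) (Rmax (Cmod (a * q ^ 2)) (Cmod (b * q ^ 2))) < 1)%R ->
  ex_series (phi32_term (q ^ 2 / a) (q ^ 2 / b) (q ^ 2)
                        (- q ^ 2) (- q ^ 3) (q ^ 2) (a * b)) /\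
  ex_series (hecke_term q a b) /\
  (qpoch_inf (q ^ 2) (q ^ 2) * qpoch_inf (a * b) (q ^ 2))
  / (qpoch_inf (a * q ^ 2) (q ^ 2) * qpoch_inf (b * q ^ 2) (q ^ 2))
  * phi32 (q ^ 2 / a) (q ^ 2 / b) (q ^ 2)
          (- q ^ 2) (- q ^ 3) (q ^ 2) (a * b)
  = (1 + q) * CSeries (hecke_term q a b).
Proof.
intros Hq0 Ha Hb Hq Hmax.
apply Rmax_Rlt in Hmax. destruct Hmax as [Hab Hmax].
apply Rmax_Rlt in Hmax. destruct Hmax as [Haq Hbq].
destruct (phi32_is_series q a b Hq Hab) as [l Hl].
destruct (swap_term_bound q a b Hq0 Ha Hb Hq Haq Hbq) as [K HK].
assert (Hq1 : 1 + q <> 0).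
{ replace (1 + q) with (1 - - q) by ring. apply Cmod_lt_1_neq.
  now rewrite Cmod_opp. }
assert (Hc : forall x : C, / (1 + q) * ((1 + q) * x) = x)
  by (intros x; field; exact Hq1).
(* Row j sums to the prefactor times the 3phi2 term of index j, while antidiagonal n sums to 1 + q
   times the Hecke-type term. *)
assert (H := is_series_triangle (swap_term q a b) _ _ K _
  (conj (Cmod_ge_0 _) Hab) HK
  (swap_term_is_series q a b Hq0 Ha Hb Hq Hab Haq Hbq)
  (is_series_C_scal (prefactor q a b) _ _ Hl)).
apply (is_series_C_scal (/ (1 + q))) in H.
apply (is_series_ext (V := C_NormedModule) _ (hecke_term q a b)) in H.
2:{ intros n. rewrite swap_term_sum by assumption. apply Hc. }
split; [now exists l|]. split; [eexists; exact H|].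
rewrite (CSeries_unique _ _ H).
unfold phi32. rewrite (CSeries_unique _ _ Hl).
fold (prefactor q a b). field. exact Hq1.
Qed.
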